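(* Let $\mathbf{S_2}=(\rho,\sigma,\tau)=\big(1+\frac{-1+i\sqrt3}{2}\cdot\frac{1+\sqrt5}{2},\,1,\,1\big)$. For $p\in\{4,5\}$, the group $\Gamma=\mathcal{T}(p,\mathbf{S_2})$ is generated by $\mathrm{Stab}_\Gamma(m(R_1))\cup\mathrm{Stab}_\Gamma(m(A))$, where $A=(R_1R_2R_3R_2^{-1})^5$.
   Context: Let $p\ge2$ be an integer and $(\rho,\sigma,\tau)\in\mathbb{C}^3$. Set $u=e^{2\pi i/(3p)}$, $\alpha=2-u^3-\bar u^3$, $\beta_1=(\bar u^2-u)\rho$, $\beta_2=(\bar u^2-u)\sigma$, $\beta_3=(\bar u^2-u)\tau$, and $H=\begin{pmatrix}\alpha&\beta_1&\bar\beta_3\\ \bar\beta_1&\alpha&\beta_2\\ \beta_3&\bar\beta_2&\alpha\end{pmatrix}$, a Hermitian matrix (of signature $(2,1)$ for the parameters considered) defining the form $\langle X,Y\rangle=Y^*HX$. Let $R_1=\begin{pmatrix}u^2&\rho&-u\bar\tau\\0&\bar u&0\\0&0&\bar u\end{pmatrix}$, $R_2=\begin{pmatrix}\bar u&0&0\\-u\bar\rho&u^2&\sigma\\0&0&\bar u\end{pmatrix}$, $R_3=\begin{pmatrix}\bar u&0&0\\0&\bar u&0\\ \tau&-u\bar\sigma&u^2\end{pmatrix}$. The group $\mathcal{T}(p,(\rho,\sigma,\tau))$ is the subgroup of $U(H)$ generated by $R_1,R_2,R_3$, acting on $H^2_{\mathbb{C}}=\{[X]:\langle X,X\rangle<0\}$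 through its image in $PU(H)$; all statements refer to this image. $R_1$ and $A$ are complex reflections (non-identity elements fixing pointwise a complex line) for these $p$; $m(\cdot)$ denotes the mirror (fixed complex line), and $\mathrm{Stab}_\Gamma(m)$ is the setwise stabilizer of $m$ in $\Gamma$. *)

(* Defs.v *)
From mathcomp Require Import all_boot all_algebra.
From mathcomp Require Import complex.
From mathcomp Require Import reals trigo.
Import GRing.Theory Num.Theory.
Set Implicit Arguments. Unset Strict Implicit. Unset Printing Implicit Defensive.
Local Open Scope ring_scope.
Local Open Scope complex_scope.

(* Complex numbers are R[i] (mathcomp-real-closed) over R : realType
   (mathcomp-analysis), so that cos/sin/pi are available. *)

Section TriangleGroups.
Variable R : realType.
Local Notation C := R[i].

(* 3x3 matrix from its rows *)
Definition mx3 (a b c d e f g h k : C) : 'M[C]_3 :=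
  \matrix_(i < 3, j < 3)
    nth 0 (nth [::] [:: [:: a; b; c]; [:: d; e; f]; [:: g; h; k]] i) j.

(* u = exp(2 pi i / (3p)) *)
Definition uu (p : nat) : C :=
  cos (2 * pi / (3 * p)%:R) +i* sin (2 * pi / (3 * p)%:R).

Definition alpha (p : nat) : C := 2 - uu p ^+ 3 - (uu p)^* ^+ 3.
Definition bcoef (p : nat) (x : C) : C := ((uu p)^* ^+ 2 - uu p) * x.

(* the Hermitian matrix H *)
Definition Hmx (p : nat) (rho sigma tau : C) : 'M[C]_3 :=
  let a := alpha p in
  let b1 := bcoef p rho in let b2 := bcoef p sigma in let b3 := bcoef p tau in
  mx3 a b1 b3^* b1^* a b2 b3 b2^* a.

(* Hermitian form <X,Y> = Y^* H X *)
Definition hform (H : 'M[C]_3) (X Y : 'cV[C]_3) : C :=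
  ((map_mx conjc Y)^T *m H *m X) 0 0.

(* generators *)
Definition R1 (p : nat) (rho sigma tau : C) : 'M[C]_3 :=
  let u := uu p in
  mx3 (u ^+ 2) rho (- u * tau^*) 0 u^* 0 0 0 u^*.
Definition R2 (p : nat) (rho sigma tau : C) : 'M[C]_3 :=
  let u := uu p in
  mx3 u^* 0 0 (- u * rho^*) (u ^+ 2) sigma 0 0 u^*.
Definition R3 (p : nat) (rho sigma tau : C) : 'M[C]_3 :=
  let u := uu p in
  mx3 u^* 0 0 0 u^* 0 tau (- u * sigma^*) (u ^+ 2).

(* subgroup of GL_3(C) generated by a set S of matrices *)
Inductive gen (S : 'M[C]_3 -> Prop) : 'M[C]_3 -> Prop :=
| gen_one : gen S 1%:M
| gen_base g : S g -> gen S g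
| gen_mul g h : gen S g -> gen S h -> gen S (g *m h)
| gen_inv g : gen S g -> gen S (invmx g).

(* the group T(p,(rho,sigma,tau)) as a matrix group *)
Definition Tgroup (p : nat) (rho sigma tau : C) : 'M[C]_3 -> Prop :=
  gen (fun g => g = R1 p rho sigma tau \/ g = R2 p rho sigma tau
                \/ g = R3 p rho sigma tau).

(* mirror of g: its fixed point set in complex hyperbolic space
   H^2_C = {[X] : <X,X> < 0}, described by representative vectors *)
Definition mirror (H : 'M[C]_3) (g : 'M[C]_3) (X : 'cV[C]_3) : Prop :=
  hform H X X < 0 /\ exists c : C, g *m X = c *: X.

(* g maps the set of points M (closed under scaling) onto itself *)
Definition stabilizes (g : 'M[C]_3) (M : 'cV[C]_3 -> Prop) : Prop :=
  forall X, M X <-> M (g *m X).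

(* the parameter S_2 *)
Definition rhoS2 : C :=
  1 + ((- (1 / 2)) +i* (Num.sqrt 3 / 2)) * ((1 + Num.sqrt 5) / 2)%:C.

End TriangleGroups.

(* Main.v *)
Require Import Defs.
From mathcomp Require Import all_boot all_algebra.
From mathcomp Require Import complex.
From mathcomp Require Import reals trigo.
From mathcomp Require Import ring.
Import GRing.Theory Num.Theory.
Local Open Scope ring_scope.
Local Open Scope complex_scope.

(** Write a, b, c for R1, R2, R3 and t = b c b^-1.  The generators satisfy the
    braid relations abab = baba, aca = cac, bcb = cbc and atata = tatat.  The
    last one makes A = (at)^5 central in <a, t>, so a and t lie in Stab(m(A)).
    The elements bab and (tata)(bac) commute with a, hence lie in Stab(m(a)).
    So the subgroup generated by the two stabilizers contains bac, then
    b^-1 c = (bab)^-1 (bac), then c = (b^-1 c) t and finally b = c t c^-1. *)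

(** * Consequences of the braid relations in a ring *)

Section BraidRelations.
Variables (G : unitRingType) (a b c t : G).

(** The word D = atata = tatat satisfies a D = D t and t D = D a, so D^2 = (at)^5 commutes with both
    letters. *)
Lemma comm_expr_braid5 : a * t * a * t * a = t * a * t * a * t ->
  GRing.comm a ((a * t) ^+ 5) /\ GRing.comm t ((a * t) ^+ 5).
Proof.
move=> D2; pose D := a * t * a * t * a; have {}D2 : D = t * a * t * a * t by [].
have aD : a * D = D * t by rewrite {1}D2 /D !mulrA.
have tD : t * D = D * a by rewrite {2}D2 /D !mulrA.
have -> : (a * t) ^+ 5 = D * D by rewrite {2}D2 /D !exprS expr0 mulr1 !mulrA.
split; first by rewrite /GRing.comm mulrA aD -mulrA tD mulrA.
by rewrite /GRing.comm mulrA tD -mulrA aD mulrA.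
Qed.

Lemma comm_braid4 : a * b * a * b = b * a * b * a -> GRing.comm a (b * a * b).
Proof. by rewrite /GRing.comm !mulrA. Qed.

(** Applying the relations in turn, a(tata)bac = (tata)(tb)ac = (tata)b(cac) = (tata)b(aca). *)
Lemma comm_braid5_braid3 : t * b = b * c -> a * c * a = c * a * c ->
  a * t * a * t * a = t * a * t * a * t ->
  GRing.comm a (t * a * t * a * (b * a * c)).
Proof.
move=> tb aca D; rewrite /GRing.comm !mulrA D -!mulrA; do 4 congr (_ * _).
by rewrite (mulrA t) tb -!mulrA; congr (_ * _); rewrite !mulrA aca.
Qed.

(** Since c t b = c b c = b c b, it remains to cancel b on the right. *)
Lemma braid3_conj : b \is a GRing.unit -> t * b = b * c ->
  b * c * b = c * b * c -> c * t = b * c.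
Proof. by move=> bU tb bcb; apply: (mulIr bU); rewrite bcb -!mulrA tb. Qed.

End BraidRelations.

(** * Isometries of the form and stabilizers of mirrors *)

Section HermitianForm.
Variable R : realType.
Local Notation C := R[i].
Implicit Types (H k r : 'M[C]_3) (X Y : 'cV[C]_3).

Definition preserves H k := (map_mx conjc k)^T *m H *m k = H.

Lemma hform_preserves H k X Y :
  preserves H k -> hform H (k *m X) (k *m Y) = hform H X Y.
Proof.
rewrite /preserves => kH.
by rewrite /hform map_mxM trmx_mul -[in RHS]kH !mulmxA.
Qed.

(** Invertibility is carried through the induction: the inverse case replaces H by g^* H g and
    cancels g g^-1 on both sides. *)
Lemma preserves_gen (S : 'M[C]_3 -> Prop) H k :
  (forall g, S g -> g \in unitmx /\ preserves H g) -> gen S k ->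
  k \in unitmx /\ preserves H k.
Proof.
move=> SH; elim=> [|g /SH //|g h _ [gU gH] _ [hU hH]|g _ [gU gH]].
- by rewrite unitmx1 /preserves map_mx1 trmx1 mul1mx mulmx1.
- rewrite unitmx_mul gU hU; split=> //; move: gH hH; rewrite /preserves => gH hH.
  by rewrite map_mxM trmx_mul -[RHS]hH -[in RHS]gH !mulmxA.
rewrite unitmx_inv; split=> //; move: gH; rewrite /preserves => gH.
rewrite -[in LHS]gH !mulmxA -trmx_mul -map_mxM mulmxV //.
by rewrite map_mx1 trmx1 mul1mx mulmxK.
Qed.

(** Commuting with [r], the matrix [k] maps each eigenspace of [r] onto itself; invariance of the
    form keeps <X,X> negative. *)
Lemma comm_stabilizes H k r : k \in unitmx -> preserves H k ->
  k *m r = r *m k -> stabilizes k (mirror H r).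
Proof.
move=> kU kH kr X; rewrite /mirror hform_preserves //.
split=> -[X0 [x rX]]; split=> //; exists x.
  by rewrite mulmxA -kr -mulmxA rX -scalemxAr.
by rewrite -[LHS](mulKmx kU) (mulmxA k) kr -mulmxA rX -scalemxAr mulKmx.
Qed.

End HermitianForm.

Arguments preserves {R}.

(** * Generation by the two stabilizers *)

Section Generation.
Variable R : realType.
Local Notation C := R[i].
Variables H r1 r2 r3 : 'M[C]_3.
Let t := r2 * r3 * r2^-1.
Let S g := g = r1 \/ g = r2 \/ g = r3.
Let Gamma := gen S.
Let A := (r1 *m r2 *m r3 *m invmx r2) ^+ 5.
Let K := gen (fun k => Gamma k /\
  (stabilizes k (mirror H r1) \/ stabilizes k (mirror H A))).

Hypothesis SH : forall g, S g -> g \in unitmx /\ preserves H g.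
Hypothesis braid12 : r1 * r2 * r1 * r2 = r2 * r1 * r2 * r1.
Hypothesis braid13 : r1 * r3 * r1 = r3 * r1 * r3.
Hypothesis braid23 : r2 * r3 * r2 = r3 * r2 * r3.
Hypothesis braid1_23 : r1 * t * r1 * t * r1 = t * r1 * t * r1 * t.

(** The matrices enter through invariance of H and four braid relations, so the argument is a
    manipulation of words in [r1], [r2], [r3]. *)
Lemma gen_mirror_stabilizers g : Gamma g -> K g.
Proof.
have GM k h : Gamma k -> Gamma h -> Gamma (k * h) by exact: gen_mul.
have KM k h : K k -> K h -> K (k * h) by exact: gen_mul.
have KV k : K k -> K k^-1 by exact: gen_inv.
have G1 : Gamma r1 by apply: gen_base; left.
have G2 : Gamma r2 by apply: gen_base; right; left.
have G3 : Gamma r3 by apply: gen_base; right; right.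
have Gt : Gamma t by exact: GM _ _ (GM _ _ G2 G3) (gen_inv G2).
have GU k : Gamma k -> k \is a GRing.unit.
  by case/(preserves_gen _ _ _ _ SH).
have AE : A = (r1 * t) ^+ 5 by rewrite /A /t !mulmxE !mulrA.
(* Source of elements of [K]: whatever in [Gamma] commutes with [r1] or [A] stabilizes its
   mirror. *)
have Kcomm k m : Gamma k -> m = r1 \/ m = A -> GRing.comm m k -> K k.
  move=> Gk mE mk; apply: gen_base; split; first exact: Gk.
  have [kU kH] := preserves_gen _ _ _ _ SH Gk.
  have km : k *m m = m *m k by exact: esym mk.
  by case: mE km => -> km; [left|right]; exact: comm_stabilizes kU kH km.
have [c1A ctA] := comm_expr_braid5 _ _ _ braid1_23.
have K1 : K r1 by exact: (Kcomm _ r1 G1 (or_introl erefl) erefl).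
have Kt : K t.
  by apply: (Kcomm _ A Gt (or_intror erefl)); rewrite AE; exact: commr_sym ctA.
have G212 : Gamma (r2 * r1 * r2) by exact: GM _ _ (GM _ _ G2 G1) G2.
have K212 : K (r2 * r1 * r2).
  exact: (Kcomm _ r1 G212 (or_introl erefl) (comm_braid4 _ _ _ braid12)).
have tb : t * r2 = r2 * r3 by exact: mulrVK (GU _ G2) _.
have ct : r3 * t = r2 * r3 by exact: braid3_conj _ _ _ _ (GU _ G2) tb braid23.
have K213 : K (r2 * r1 * r3).
  have Gtata : Gamma (t * r1 * t * r1) by exact: GM _ _ (GM _ _ (GM _ _ Gt G1) Gt) G1.
  have Ktata : K (t * r1 * t * r1) by exact: KM _ _ (KM _ _ (KM _ _ Kt K1) Kt) K1.
  have Gw : Gamma (t * r1 * t * r1 * (r2 * r1 * r3)).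
    exact: GM _ _ Gtata (GM _ _ (GM _ _ G2 G1) G3).
  have Kw := Kcomm _ r1 Gw (or_introl erefl)
    (comm_braid5_braid3 _ _ _ _ _ tb braid13 braid1_23).
  (* The factor tata already lies in [K] and can be cancelled. *)
  by rewrite -[r2 * r1 * r3](mulKr (GU _ Gtata)); exact: KM _ _ (KV _ Ktata) Kw.
have K3 : K r3.
  (* By [ct], (r2 r1 r2) r3 = (r2 r1 r3) t; this is solved for [r3]. *)
  have -> : r3 = (r2 * r1 * r2)^-1 * (r2 * r1 * r3) * t.
    apply: (mulrI (GU _ G212)).
    by rewrite -[_^-1 * _ * t]mulrA (mulVKr (GU _ G212)) -!mulrA ct.
  exact: KM _ _ (KM _ _ (KV _ K212) K213) Kt.
have K2 : K r2.
  have -> : r2 = r3 * t * r3^-1 by rewrite ct (mulrK (GU _ G3)).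
  exact: KM _ _ (KM _ _ K3 Kt) (KV _ K3).
elim=> [|k [->|[->|->]]|k h _ Kk _ Kh|k _ Kk].
- exact: gen_one.
- exact: K1.
- exact: K2.
- exact: K3.
- exact: KM _ _ Kk Kh.
- exact: KV _ Kk.
Qed.

End Generation.

(** * Explicit 3x3 matrices and complex conjugation *)

Section Generators.
Variable R : realType.
Local Notation C := R[i].

Lemma mulmx_mx3 (a b c d e f g h k a' b' c' d' e' f' g' h' k' : C) :
  mx3 a b c d e f g h k *m mx3 a' b' c' d' e' f' g' h' k' =
  mx3 (a * a' + b * d' + c * g') (a * b' + b * e' + c * h')
      (a * c' + b * f' + c * k')
      (d * a' + e * d' + f * g') (d * b' + e * e' + f * h')
      (d * c' + e * f' + f * k')
      (g * a' + h * d' + k * g') (g * b' + h * e' + k * h')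
      (g * c' + h * f' + k * k').
Proof.
apply/matrixP=> i j; rewrite !mxE !big_ord_recl big_ord0 !mxE /= addr0 addrA.
by case: i => [[|[|[|i]]] ?] //=; case: j => [[|[|[|j]]] ?].
Qed.

Lemma mx3_1 : mx3 1 0 0 0 1 0 0 0 1 = 1 :> 'M[C]_3.
Proof.
apply/matrixP=> i j; rewrite !mxE.
by case: i => [[|[|[|i]]] ?] //=; case: j => [[|[|[|j]]] ?].
Qed.

Lemma map_trmx_mx3 (f : C -> C) (a b c d e g h k l : C) :
  (map_mx f (mx3 a b c d e g h k l))^T =
  mx3 (f a) (f d) (f h) (f b) (f e) (f k) (f c) (f g) (f l).
Proof.
apply/matrixP=> i j; rewrite !mxE.
by case: i => [[|[|[|i]]] ?] //=; case: j => [[|[|[|j]]] ?].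
Qed.

Lemma conjcM (x y : C) : conjc (x * y) = conjc x * conjc y.
Proof. exact: (rmorphM Num.conj). Qed.

Lemma conjcN (x : C) : conjc (- x) = - conjc x.
Proof. exact: (rmorphN Num.conj). Qed.

Lemma conjcD (x y : C) : conjc (x + y) = conjc x + conjc y.
Proof. exact: (rmorphD Num.conj). Qed.

Lemma conjcX (x : C) n : conjc (x ^+ n) = conjc x ^+ n.
Proof. exact: (rmorphXn Num.conj). Qed.

(** * Braid relations and invariance as polynomial identities; [v] and [s] stand for the conjugates
    of [u] and [r] *)

Section Relations.
Variables u v r s : C.
Hypothesis uv : u * v = 1.

Local Notation M1 := (mx3 (u ^+ 2) r (- u) 0 v 0 0 0 v).
Local Notation M2 := (mx3 v 0 0 (- u * s) (u ^+ 2) 1 0 0 v).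
Local Notation M3 := (mx3 v 0 0 0 v 0 1 (- u) (u ^+ 2)).
Local Notation M2inv := (mx3 u 0 0 s (v ^+ 2) (- v) 0 0 u).

Lemma unitmx_M1 : M1 \in unitmx.
Proof.
suff /mulmx1_unit[] : M1 *m mx3 (v ^+ 2) (- v * r) 1 0 u 0 0 0 u = 1 by [].
by rewrite mulmx_mx3 -mx3_1; congr mx3; ring: uv.
Qed.

Lemma mulmx_M2inv : M2 *m M2inv = 1.
Proof. by rewrite mulmx_mx3 -mx3_1; congr mx3; ring: uv. Qed.

Lemma unitmx_M3 : M3 \in unitmx.
Proof.
suff /mulmx1_unit[] : M3 *m mx3 u 0 0 0 u 0 (- v) 1 (v ^+ 2) = 1 by [].
by rewrite mulmx_mx3 -mx3_1; congr mx3; ring: uv.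
Qed.

Lemma invM2E : M2^-1 = M2inv.
Proof.
have [M2U _] := mulmx1_unit mulmx_M2inv.
by apply: (mulrI M2U); rewrite divrr // -mulmxE mulmx_M2inv.
Qed.

(** Reflections of this shape with parameter of modulus 2 cos(pi/n) satisfy the braid relation of
    length n; modulus 1 gives n = 3. *)
Lemma braid3_M1_M3 : M1 * M3 * M1 = M3 * M1 * M3.
Proof. by rewrite -!mulmxE !mulmx_mx3; congr mx3; ring: uv. Qed.

Lemma braid3_M2_M3 : M2 * M3 * M2 = M3 * M2 * M3.
Proof. by rewrite -!mulmxE !mulmx_mx3; congr mx3; ring: uv. Qed.

Hypothesis rs : r * s = 2.

(** Here r s is the squared modulus, and 2 = (2 cos(pi/4))^2 gives length 4. *)
Lemma braid4_M1_M2 : M1 * M2 * M1 * M2 = M2 * M1 * M2 * M1.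
Proof. by rewrite -!mulmxE !mulmx_mx3; congr mx3; ring: uv rs. Qed.

(** This is (2 - r - s)^2 = (2 - r - s) + 1, the equation of the golden ratio,
    modulo r s = 2. *)
Hypothesis r2 : r ^+ 2 = 3 * r + 3 * s - s ^+ 2 - 5.

(** Completes [rs] and [r2] to a Groebner basis, so that [ring] decides
    equalities modulo these relations. *)
Lemma s3 : s ^+ 3 = 3 * s ^+ 2 - 5 * s + 6 - 2 * r.
Proof.
apply/eqP; rewrite -subr_eq0; apply/eqP.
(* The S-polynomial of [r2] and [rs], with its term in r s reduced by [rs]. *)
transitivity ((r ^+ 2 - (3 * r + 3 * s - s ^+ 2 - 5)) * s
              + (3 - r) * (r * s - 2)); first by ring.
by rewrite r2 rs !subrr mul0r mulr0 addr0.
Qed.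

(** The parameter linking [M1] to [t] is r - 1, and (r - 1)(s - 1) = 3 - r - s = (2 - r - s)^2. When
    2 - r - s is the golden ratio 2 cos(pi/5), this is the value for length 5. *)
Lemma braid5_M1_M23 : let t := M2 * M3 * M2^-1 in
  M1 * t * M1 * t * M1 = t * M1 * t * M1 * t.
Proof.
rewrite invM2E => t; rewrite {}/t -!mulmxE !mulmx_mx3.
by congr mx3; ring: uv rs r2 s3.
Qed.

Let a := 2 - u ^+ 3 - v ^+ 3.
Let b := v ^+ 2 - u.
Let b' := u ^+ 2 - v.
Local Notation M0 := (mx3 a (b * r) b' (b' * s) a b b b' a).

(** The left factor is the conjugate transpose of [M1]: conjugation exchanges u with v and r with s.
    The next two lemmas have the same form. *)
Lemma M1_preserves_M0 : mx3 (v ^+ 2) 0 0 s u 0 (- v) 0 u *m M0 *m M1 = M0.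
Proof. by rewrite !mulmx_mx3 /a /b /b'; congr mx3; ring: uv rs. Qed.

Lemma M2_preserves_M0 : mx3 u (- v * r) 0 0 (v ^+ 2) 0 0 1 u *m M0 *m M2 = M0.
Proof. by rewrite !mulmx_mx3 /a /b /b'; congr mx3; ring: uv rs. Qed.

Lemma M3_preserves_M0 : mx3 u 0 1 0 u (- v) 0 0 (v ^+ 2) *m M0 *m M3 = M0.
Proof. by rewrite !mulmx_mx3 /a /b /b'; congr mx3; ring: uv. Qed.

End Relations.

(** * Specialization to u = exp(2 pi i/(3p)) and the parameter S_2 *)

Variable p : nat.
Local Notation u := (uu R p).
Local Notation v := (conjc u).
Local Notation r := (rhoS2 R).
Local Notation s := (conjc r).
Local Notation r1 := (R1 p r 1 1).
Local Notation r2 := (R2 p r 1 1).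
Local Notation r3 := (R3 p r 1 1).

Lemma uu_conj : u * v = 1.
Proof.
rewrite /uu; apply/eqP; rewrite eq_complex /=; apply/andP; split; apply/eqP.
  by rewrite mulrN opprK -!expr2 cos2Dsin2.
by ring.
Qed.

(** With golden ratio phi and primitive cube root of unity w, |1 + w phi|^2 = 1 - phi + phi^2 =
    2. *)
Lemma rho_conj : r * s = 2.
Proof.
have q3 : Num.sqrt 3 ^+ 2 = 3 :> R by rewrite sqr_sqrtr.
have q5 : Num.sqrt 5 ^+ 2 = 5 :> R by rewrite sqr_sqrtr.
rewrite /rhoS2; apply/eqP; rewrite eq_complex /=; apply/andP.
by split; apply/eqP; field: q3 q5.
Qed.

(** The sum of [r] and its conjugate is 2 - phi, so this encodes phi^2 = phi + 1. *)
Lemma rho_sqr : r ^+ 2 = 3 * r + 3 * s - s ^+ 2 - 5.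
Proof.
have q3 : Num.sqrt 3 ^+ 2 = 3 :> R by rewrite sqr_sqrtr.
have q5 : Num.sqrt 5 ^+ 2 = 5 :> R by rewrite sqr_sqrtr.
rewrite /rhoS2; apply/eqP; rewrite eq_complex /=; apply/andP.
by split; apply/eqP; field: q3 q5.
Qed.

(** In Defs, [^*] elaborates to [conjc] or to [Num.conj] depending on the
    expected type. *)
Let conjCE (x : C) : Num.conj x = conjc x. Proof. by []. Qed.

Lemma R1E : r1 = mx3 (u ^+ 2) r (- u) 0 v 0 0 0 v.
Proof. by rewrite /R1 conjCE conjc1 mulr1. Qed.

Lemma R2E : r2 = mx3 v 0 0 (- u * s) (u ^+ 2) 1 0 0 v.
Proof. by rewrite /R2 conjCE. Qed.

Lemma R3E : r3 = mx3 v 0 0 0 v 0 1 (- u) (u ^+ 2).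
Proof. by rewrite /R3 conjCE conjc1 mulr1. Qed.

Lemma HmxE : let a := 2 - u ^+ 3 - v ^+ 3 in
  let b := v ^+ 2 - u in let b' := u ^+ 2 - v in
  Hmx p r 1 1 = mx3 a (b * r) b' (b' * s) a b b b' a.
Proof.
rewrite /Hmx /alpha /bcoef !conjCE mulr1.
by rewrite !(conjcM, conjcD, conjcN, conjcX) conjcK.
Qed.

Let conjcE := (conjcM, conjcN, conjcX, conjcK, @conjc1 R, @conjc0 R).

Lemma generators_preserve g : g = r1 \/ g = r2 \/ g = r3 ->
  g \in unitmx /\ preserves (Hmx p r 1 1) g.
Proof.
rewrite /preserves HmxE; case=> [->|[->|->]]; split.
- by rewrite R1E; exact: unitmx_M1 uu_conj.
- rewrite R1E map_trmx_mx3 !conjcE.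
  exact: M1_preserves_M0 uu_conj rho_conj.
- rewrite R2E; exact: (proj1 (mulmx1_unit (mulmx_M2inv _ _ _ uu_conj))).
- rewrite R2E map_trmx_mx3 !conjcE.
  exact: M2_preserves_M0 uu_conj rho_conj.
- by rewrite R3E; exact: unitmx_M3 uu_conj.
- rewrite R3E map_trmx_mx3 !conjcE.
  exact: M3_preserves_M0 uu_conj.
Qed.

Lemma braid_R1_R2 : r1 * r2 * r1 * r2 = r2 * r1 * r2 * r1.
Proof. rewrite R1E R2E; exact: braid4_M1_M2 uu_conj rho_conj. Qed.

Lemma braid_R1_R3 : r1 * r3 * r1 = r3 * r1 * r3.
Proof. rewrite R1E R3E; exact: braid3_M1_M3 uu_conj. Qed.

Lemma braid_R2_R3 : r2 * r3 * r2 = r3 * r2 * r3.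
Proof. rewrite R2E R3E; exact: braid3_M2_M3 uu_conj. Qed.

Lemma braid_R1_R23 : let t := r2 * r3 * r2^-1 in
  r1 * t * r1 * t * r1 = t * r1 * t * r1 * t.
Proof.
rewrite R1E R2E R3E; exact: braid5_M1_M23 uu_conj rho_conj rho_sqr.
Qed.

End Generators.

Theorem theorem11p4 (R : realType) (p : nat) (hp : p = 4%N \/ p = 5%N) :
  let rho := rhoS2 R in
  let H := Hmx p rho 1 1 in
  let r1 := R1 p rho 1 1 in let r2 := R2 p rho 1 1 in let r3 := R3 p rho 1 1 in
  let A := (r1 *m r2 *m r3 *m invmx r2) ^+ 5 in
  let Gamma := Tgroup p rho 1 1 in
  forall g, Gamma g ->
    exists2 h,
      gen (fun k => Gamma k /\
                    (stabilizes k (mirror H r1) \/ stabilizes k (mirror H A))) h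
      & exists c : R[i], c != 0 /\ g = c *: h.
Proof.
move=> rho H r1 r2 r3 A Gamma g Gg.
(* Generation holds already for matrices, so the projective scalar is 1. *)
exists g; last by exists 1; rewrite oner_neq0 scale1r.
exact: (gen_mirror_stabilizers _ _ _ _ _ (@generators_preserve R p)
  (braid_R1_R2 R p) (braid_R1_R3 R p) (braid_R2_R3 R p) (braid_R1_R23 R p)).
Qed.
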